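(* Let $\Omega\subset\mathbb{R}^d$ be open, let $\nu:\mathbb{R}^d\setminus\{0\}\to[0,\infty)$ be a symmetric Lévy density, and let $k:(\mathbb{R}^d\times\mathbb{R}^d)\setminus\operatorname{diag}\to[0,\infty)$ be symmetric and measurable such that for some $\Lambda\ge1$, $\Lambda^{-1}\nu(y-x)\le k(x,y)\le\Lambda\,\nu(y-x)$ for all $x\ne y$. Let $f\in L^2(\Omega)$. Assume $u\in V_\nu(\Omega|\mathbb{R}^d)$ minimizes the functional $$v\mapsto\tfrac12\mathcal{E}(v,v)-\int_\Omega f(x)v(x)\,dx$$ in the space $V_\nu(\Omega|\mathbb{R}^d)$. Then $\mathcal{N}u=0$ in $\Omega^c$.
   Context: $\Omega^c=\mathbb{R}^d\setminus\Omega$ is the complement of $\Omega$. A symmetric Lévy density is a measurable $\nu\ge0$ with $\nu(h)=\nu(-h)$ and $\int_{\mathbb{R}^d}(1\wedge|h|^2)\nu(h)\,dh<\infty$. $V_\nu(\Omega|\mathbb{R}^d)$ is the space of measurable $u:\mathbb{R}^d\to\mathbb{R}$ with $u|_\Omega\in L^2(\Omega)$ and $\int_\Omega\int_{\mathbb{R}^d}(u(x)-u(y))^2\nu(x-y)\,dy\,dx<\infty$. The energy form is $\mathcal{E}(u,v)=\frac12\iint_{(\Omega^c\times\Omega^c)^c}(u(x)-u(y))(v(x)-v(y))\,k(x,y)\,dx\,dy$. The nonlocal normal derivative is $\mathcal{N}u(y)=\int_\Omega(u(y)-u(x))\,k(x,y)\,dx$ for $y\in\Omega^c$. Functions are understood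 up to equality almost everywhere.
   Formalization: Nu = 0 is proved for almost every y in the complement of Ω with ∫_Ω k(x,y)dx finite; this always holds off the closure of Ω. On a boundary of positive measure where it fails, the integral defining Nu(y) may diverge. *)

(* Defs.v *)
From HB Require Import structures.
From mathcomp Require Import all_boot all_order all_algebra.
From mathcomp Require Import all_classical all_reals all_analysis.
From mathcomp Require Import measurable_realfun.

Set Implicit Arguments.
Unset Strict Implicit.
Unset Printing Implicit Defensive.

Import Order.TTheory GRing.Theory Num.Theory.
Import numFieldNormedType.Exports.

Local Open Scope classical_set_scope.
Local Open Scope ring_scope.

(* R^n is 'rV[R]_n with the library's topology, here equipped with the
   sigma-algebra generated by the coordinates.  By measurable_rV_open below
   this is the Borel sigma-algebra. *)

Definition measure_rV_display : measure_display.
Proof. exact: default_measure_display. Qed.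

Section rV_measurable.
Variables (R : realType) (n : nat).

Let coord (i : 'I_n) (x : 'rV[R]_n) : measurableTypeR R := x ord0 i.

Let rV_set0 : g_sigma_preimage coord set0.
Proof. exact: sigma_algebra0. Qed.

Let rV_setC A : g_sigma_preimage coord A -> g_sigma_preimage coord (~` A).
Proof. exact: sigma_algebraC. Qed.

Let rV_bigcup (F : (set 'rV[R]_n)^nat) :
  (forall i, g_sigma_preimage coord (F i)) ->
  g_sigma_preimage coord (\bigcup_i (F i)).
Proof. exact: sigma_algebra_bigcup. Qed.

HB.instance Definition _ := @isMeasurable.Build measure_rV_display
  'rV[R]_n (g_sigma_preimage coord) rV_set0 rV_setC rV_bigcup.

Lemma measurable_coord (i : 'I_n) :
  measurable_fun [set: 'rV[R]_n] (fun x => x ord0 i : measurableTypeR R).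
Proof.
move=> _ Y mY; rewrite setTI; apply: sub_sigma_algebra => /=.
rewrite -bigcup_seq/=; exists i => /=; first by rewrite mem_index_enum.
by exists Y => //; rewrite setTI.
Qed.

Lemma measurable_fun_rV d (T : measurableType d) (f : T -> 'rV[R]_n) :
  (forall i, measurable_fun [set: T] (fun t => f t ord0 i : measurableTypeR R)) ->
  measurable_fun [set: T] f.
Proof.
move=> mf.
have H : g_sigma_preimage (fun i => coord i \o f) `<=` measurable.
  apply: smallest_sub; first exact: sigma_algebra_measurable.
  rewrite -bigcup_seq; apply: bigcup_sub => i _ A [B mB <-]; exact: mf.
rewrite g_sigma_preimage_comp in H.
by move=> _ A mA; apply: H; exists A.
Qed.

Lemma measurable_rV_open (A : set 'rV[R]_n) : open A -> measurable A.
Proof.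
move=> oA.
pose box (q : {ffun 'I_n -> rat * rat}) : set 'rV[R]_n :=
  [set x | forall i, `]ratr (q i).1, ratr (q i).2[%classic (x ord0 i)].
have mbox q : measurable (box q).
  have -> : box q = \bigcap_(i in [set: 'I_n])
      ((fun x : 'rV[R]_n => x ord0 i : measurableTypeR R) @^-1`
        `]ratr (q i).1, ratr (q i).2[%classic).
    by rewrite eqEsubset; split => [x xq i _|x xq i]; [exact: xq|exact: (xq i)].
  apply: fin_bigcap_measurable; first exact: finite_finset.
  move=> i _; rewrite -[X in measurable X]setTI.
  by apply: measurable_coord => //; exact: measurable_itv.
have -> : A = \bigcup_(q in [set q | box q `<=` A]) box q.
  rewrite eqEsubset; split => [x Ax|x [q] qA /qA//].
  have /nbhs_ballP[e /= e0 xeA] : nbhs x A by exact: open_nbhs_nbhs.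
  have lo i : {q : rat | ratr q \in `](x ord0 i - e), (x ord0 i)[}.
    by apply/cid; apply: rat_in_itvoo; rewrite ltrBlDr ltrDl.
  have hi i : {q : rat | ratr q \in `](x ord0 i), (x ord0 i + e)[}.
    by apply/cid; apply: rat_in_itvoo; rewrite ltrDl.
  exists [ffun i => (sval (lo i), sval (hi i))].
  - move=> y /= yb; apply: xeA; split => // i j.
    rewrite !ord1; have := yb j; rewrite /= ffunE/= in_itv/=.
    case: (lo j) (hi j) => [a /=] + [b /=].
    rewrite !in_itv/= => /andP[a1 a2] /andP[b1 b2] /andP[c1 c2].
    rewrite -[ball _ _ _]/(`|x ord0 j - y ord0 j| < e : Prop).
    rewrite ltr_distlC; apply/andP; split.
      exact: (lt_trans a1).
    exact: (lt_trans c2).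
  - move=> i /=; rewrite ffunE/= in_itv/=.
    case: (lo i) (hi i) => [a /=] + [b /=].
    by rewrite !in_itv/= => /andP[_ ->] /andP[-> _].
rewrite bigcup_mkcond; apply: countable_bigcupT_measurable => [|q].
  exact: countableP.
by case: ifP => _; [exact: mbox|exact: measurable0].
Qed.

End rV_measurable.

(* Lebesgue measure on R^n by recursion: R^0 is a point, and R^(n+1) carries
   the image of the product measure under (a, x) |-> (a, x_1, ..., x_n). *)

Definition rV_cons (R : realType) (n : nat)
    (p : measurableTypeR R * 'rV[R]_n) : 'rV[R]_n.+1 :=
  \row_i (if unlift ord0 i is Some j then p.2 ord0 j else p.1).

Section rV_cons.
Variables (R : realType) (n : nat).

Lemma measurable_rV_cons : measurable_fun setT (@rV_cons R n).
Proof.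
apply: measurable_fun_rV => i; rewrite /rV_cons.
case: (unliftP ord0 i) => [j|] ->.
  rewrite [X in measurable_fun _ X](_ : _ =
    (fun x : 'rV[R]_n => x ord0 j : measurableTypeR R) \o snd).
    by apply: measurableT_comp => //; exact: measurable_coord.
  by apply/funext => p /=; rewrite mxE liftK.
rewrite [X in measurable_fun _ X](_ : _ = fst) //.
by apply/funext => p /=; rewrite mxE unlift_none.
Qed.

Variable mu : {sigma_finite_measure set 'rV[R]_n -> \bar R}.

Definition lebesgue_cons : set 'rV[R]_n.+1 -> \bar R :=
  pushforward (@lebesgue_measure R \x mu)%E (@rV_cons R n).

Let lebesgue_cons0 : lebesgue_cons set0 = 0%E.
Proof. by rewrite /lebesgue_cons /pushforward preimage_set0 measure0. Qed.

Let lebesgue_cons_ge0 A : (0 <= lebesgue_cons A)%E.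
Proof. by rewrite /lebesgue_cons /pushforward measure_ge0. Qed.

Let lebesgue_cons_sigma_additive : semi_sigma_additive lebesgue_cons.
Proof.
move=> F mF tF mUF; rewrite /lebesgue_cons /pushforward preimage_bigcup.
apply: measure_semi_sigma_additive.
- by move=> k; rewrite -[X in measurable X]setTI; exact: measurable_rV_cons.
- apply/trivIsetP => /= i j _ _ ij; rewrite -preimage_setI.
  by move/trivIsetP : tF => /(_ i j) ->//; rewrite preimage_set0.
- rewrite -preimage_bigcup -[X in measurable X]setTI.
  exact: measurable_rV_cons.
Qed.

HB.instance Definition _ := isMeasure.Build _ _ _ lebesgue_cons
  lebesgue_cons0 lebesgue_cons_ge0 lebesgue_cons_sigma_additive.

Let lebesgue_cons_sigma_finite : sigma_finite setT lebesgue_cons.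
Proof.
have /sigma_finiteP[F [TF ndF Foo]] := sigma_finiteT (@lebesgue_measure R).
have /sigma_finiteP[G [TG ndG Goo]] := sigma_finiteT mu.
pose unc (y : 'rV[R]_n.+1) : measurableTypeR R * 'rV[R]_n :=
  (y ord0 ord0, \row_j y ord0 (lift ord0 j)).
have munc : measurable_fun setT unc.
  apply/measurable_fun_pairP; split; first exact: measurable_coord.
  apply: measurable_fun_rV => j /=.
  rewrite [X in measurable_fun _ X](_ : _ = (fun y : 'rV[R]_n.+1 =>
    y ord0 (lift ord0 j) : measurableTypeR R)); first exact: measurable_coord.
  by apply/funext => y /=; rewrite mxE.
have cK : cancel (@rV_cons R n) unc.
  move=> [a x]; rewrite /unc /rV_cons mxE unlift_none; congr pair.
  by apply/rowP => j; rewrite !mxE liftK.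
exists (fun k => unc @^-1` (F k `*` G k)).
  rewrite -preimage_bigcup [X in _ @^-1` X](_ : _ = setT) ?preimage_setT//.
  rewrite -setXTT TF TG predeqE => -[x y]; split.
    by move=> [k _ [Fkx Gky]]; split; exists k.
  move=> [/= [i _ Fix] [k _ Gky]]; exists (maxn i k) => //; split.
  - by move: x Fix; exact/subsetPset/ndF/leq_maxl.
  - by move: y Gky; exact/subsetPset/ndG/leq_maxr.
move=> k; have [mFk Fkoo] := Foo k; have [mGk Gkoo] := Goo k; split.
  by rewrite -[X in measurable X]setTI; apply: munc => //; exact: measurableX.
rewrite /lebesgue_cons /pushforward.
rewrite [X in (_ X < _)%E](_ : _ = F k `*` G k); last first.
  by apply/funext => p; exact: (congr1 (F k `*` G k) (cK p)).
by rewrite product_measure1E// lte_mul_pinfty// ge0_fin_numE.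
Qed.

HB.instance Definition _ := Measure_isSigmaFinite.Build _ _ _ lebesgue_cons
  lebesgue_cons_sigma_finite.

End rV_cons.

Fixpoint lebesgue_rV (R : realType) (n : nat) :
    {sigma_finite_measure set 'rV[R]_n -> \bar R} :=
  match n with
  | 0 => \d_(0 : 'rV[R]_0)
  | m.+1 => lebesgue_cons (lebesgue_rV R m)
  end.

Lemma lebesgue_rV_box (R : realType) (n : nat)
    (A : 'I_n -> set (measurableTypeR R)) : (forall i, measurable (A i)) ->
  (lebesgue_rV R n [set x | forall i, A i (x ord0 i)] =
   \prod_(i < n) lebesgue_measure (A i))%E.
Proof.
elim: n A => [A _|n IHn A mA] /=.
  rewrite big_ord0 diracE mem_set//=; by case.
have -> : lebesgue_cons (lebesgue_rV R n) [set x | forall i, A i (x ord0 i)] =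
    (lebesgue_measure \x lebesgue_rV R n)%E
      (A ord0 `*` [set x : 'rV[R]_n | forall i, A (lift ord0 i) (x ord0 i)]).
  rewrite /lebesgue_cons /pushforward; congr (_ _).
  rewrite eqEsubset; split => -[a x] /=; rewrite /rV_cons /=.
    move=> xA; split; first by have := xA ord0; rewrite mxE unlift_none.
    by move=> i; have := xA (lift ord0 i); rewrite mxE liftK.
  by move=> [Aa xA] i; rewrite mxE; case: unliftP => [j|] ->.
rewrite product_measure1E//; last first.
  rewrite (_ : mkset _ = \bigcap_(i in [set: 'I_n])
      ((fun x : 'rV[R]_n => x ord0 i : measurableTypeR R) @^-1` A (lift ord0 i))).
    apply: fin_bigcap_measurable; first exact: finite_finset.
    move=> i _; rewrite -[X in measurable X]setTI.
    exact: measurable_coord.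
  by rewrite eqEsubset; split => [x xq i _|x xq i]; [exact: xq|exact: (xq i)].
rewrite big_ord_recl; congr (_ * _)%E.
by apply: (IHn (fun i => A (lift ord0 i))) => i; exact: mA.
Qed.

Section translation.
Variable R : realType.

Let lebesgue_measure_shift (a : R) (A : set (measurableTypeR R)) :
  measurable A ->
  pushforward lebesgue_measure
    ((fun s => s + a) : measurableTypeR R -> measurableTypeR R) A =
  lebesgue_measure A.
Proof.
have ms : measurable_fun [set: measurableTypeR R]
    ((fun s => s + a) : measurableTypeR R -> measurableTypeR R).
  exact: measurable_funD.
move=> mA; apply/esym.
have := @lebesgue_measure_unique R (measure_function_pushforward__canonical__measure_function_Measure lebesgue_measure ms).
move=> /(_ _ _ mA); apply => _ [[b c] _ <-] /=.
rewrite /pushforward (_ : _ @^-1` _ = `]b - a, c - a]%classic); last first.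
  by apply/seteqP; split => x /=; rewrite !in_itv/= ltrBlDr lerBrDr.
rewrite !lebesgue_measure_itv/= !lte_fin ltrD2r.
by rewrite -!EFinB; case: ifP => // _; congr EFin; rewrite opprB addrA subrK.
Qed.

Lemma measurable_shift_rV (n : nat) (a : 'rV[R]_n) :
  measurable_fun [set: 'rV[R]_n] (fun x => x + a).
Proof.
apply: measurable_fun_rV => i.
rewrite [X in measurable_fun _ X](_ : _ =
    (fun x : 'rV[R]_n => (x ord0 i : measurableTypeR R) + a ord0 i)).
  apply: (@measurable_funD _ _ R) => //; exact: measurable_coord.
by apply/funext => x; rewrite mxE.
Qed.

Lemma lebesgue_rV_shift (n : nat) (a : 'rV[R]_n) (A : set 'rV[R]_n) :
  measurable A -> lebesgue_rV R n ((fun x => x + a) @^-1` A) = lebesgue_rV R n A.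
Proof.
elim: n a A => [a A mA|n IHn a A mA].
  by congr (lebesgue_rV R 0 _); apply/seteqP; split => x /=; rewrite !thinmx0.
rewrite /= /lebesgue_cons /pushforward.
pose B := @rV_cons R n @^-1` A.
rewrite -/B.
have mB : measurable B.
  by rewrite -[X in measurable X]setTI; apply: measurable_rV_cons.
pose a' : 'rV[R]_n := \row_j a ord0 (lift ord0 j).
have consD s x : rV_cons (s, x) + a = rV_cons (s + a ord0 ord0, x + a').
  by apply/rowP => i; rewrite !mxE; case: unliftP => [j|] -> //=; rewrite !mxE.
have -> : (@rV_cons R n @^-1` ((fun x => x + a) @^-1` A) =
    [set p | B (p.1 + a ord0 ord0, p.2 + a')])%classic.
  by apply/seteqP; split => -[s x]; rewrite /B /preimage/= consD.
rewrite /product_measure1.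
transitivity (\int[@lebesgue_measure R]_s
   (lebesgue_rV R n \o xsection B) ((s : R) + a ord0 ord0)%R)%E.
  apply: eq_integral => s _ /=; rewrite -[RHS](IHn a'); last exact: measurable_xsection.
  by congr (lebesgue_rV R n _); apply/seteqP; split => x /=; rewrite /xsection/= !inE.
have ms : measurable_fun [set: measurableTypeR R]
    ((fun s => s + a ord0 ord0) : measurableTypeR R -> measurableTypeR R).
  exact: measurable_funD.
have := @ge0_integral_pushforward _ _ _ _ R _ ms lebesgue_measure setT
  (lebesgue_rV R n \o xsection B) measurableT.
rewrite preimage_setT => <-.
- by apply: eq_measure_integral => C mC _; exact: lebesgue_measure_shift.
- exact: measurable_fun_xsection.
- by move=> *; exact: measure_ge0.
Qed.

End translation.

(* The kernels nu and k are total functions, but only their values off the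
   origin, resp. off the diagonal, are ever constrained or used: every integral
   below either multiplies the value at x = y by 0 or ranges over x in Omega
   with y outside Omega. *)

Section nonlocal.
Variables (R : realType) (d : nat).
Local Notation Rd := 'rV[R]_d.
Local Notation lambda := (lebesgue_rV R d).

(* The squared Euclidean norm; the library's norm on 'rV is the sup norm. *)
Definition sqnorm2 (h : Rd) : R := \sum_(i < d) h ord0 i ^+ 2.

Definition symmetric_levy_density (nu : Rd -> R) : Prop :=
  [/\ measurable_fun [set h : Rd | h <> 0] nu,
      forall h, h <> 0 -> 0 <= nu h,
      forall h, h <> 0 -> nu (- h) = nu h &
      (\int[lambda]_h (Num.min 1 (sqnorm2 h) * nu h)%:E < +oo)%E].

Definition symmetric_kernel (k : Rd -> Rd -> R) : Prop :=
  [/\ measurable_fun [set z : Rd * Rd | z.1 <> z.2] (fun z => k z.1 z.2),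
      forall x y, x <> y -> 0 <= k x y &
      forall x y, x <> y -> k x y = k y x].

Definition in_L2 (Omega : set Rd) (f : Rd -> R) : Prop :=
  measurable_fun Omega f /\ (\int[lambda]_(x in Omega) (f x ^+ 2)%:E < +oo)%E.

Definition in_V (nu : Rd -> R) (Omega : set Rd) (u : Rd -> R) : Prop :=
  [/\ measurable_fun [set: Rd] u,
      in_L2 Omega u &
      (\int[lambda]_(x in Omega) \int[lambda]_y
         ((u x - u y) ^+ 2 * nu (x - y))%:E < +oo)%E].

Definition energy (k : Rd -> Rd -> R) (Omega : set Rd) (u v : Rd -> R) : \bar R :=
  ((2^-1)%:E *
   \int[lambda \x lambda]_(z in ~` (~` Omega `*` ~` Omega))
     ((u z.1 - u z.2) * (v z.1 - v z.2) * k z.1 z.2)%:E)%E.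

Definition energy_functional (k : Rd -> Rd -> R) (Omega : set Rd) (f v : Rd -> R) :
    \bar R :=
  ((2^-1)%:E * energy k Omega v v - \int[lambda]_(x in Omega) (f x * v x)%:E)%E.

Definition minimizes (nu : Rd -> R) (k : Rd -> Rd -> R) (Omega : set Rd)
    (f u : Rd -> R) : Prop :=
  in_V nu Omega u /\
  forall v, in_V nu Omega v ->
    (energy_functional k Omega f u <= energy_functional k Omega f v)%E.

(* An extended-real integral: it is -oo, in particular not 0, when the positive
   and the negative part both have infinite integral. *)
Definition normal_derivative (k : Rd -> Rd -> R) (Omega : set Rd) (u : Rd -> R)
    (y : Rd) : \bar R :=
  (\int[lambda]_(x in Omega) ((u y - u x) * k x y)%:E)%E.

Let measurable_diag : measurable [set z : Rd * Rd | z.1 <> z.2].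
Proof.
rewrite (_ : mkset _ = \bigcup_(i in [set: 'I_d])
    ((fun z : Rd * Rd => z.1 ord0 i - z.2 ord0 i) @^-1` [set~ 0])).
  apply: fin_bigcup_measurable; first exact: finite_finset.
  move=> i _; rewrite -[X in measurable X]setTI.
  have m1 : measurable_fun setT (fun z : Rd * Rd => z.1 ord0 i : R).
    by apply: (measurableT_comp (measurable_coord i)).
  have m2 : measurable_fun setT (fun z : Rd * Rd => z.2 ord0 i : R).
    by apply: (measurableT_comp (measurable_coord i)).
  by apply: (measurable_funB m1 m2) => //; exact: measurableC.
apply/seteqP; split => [[x y]/= xy|[x y] [i _] /= + xy].
  apply: contrapT => H; apply: xy; apply/rowP => i; apply/eqP.
  rewrite -subr_eq0; apply/negPn/negP => /eqP xyi.
  by apply: H; exists i.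
by rewrite xy subrr.
Qed.

Let measurable_sqnorm2 : measurable_fun setT sqnorm2.
Proof.
rewrite /sqnorm2; apply: measurable_sum => i.
exact: (measurable_funX 2 (@measurable_coord R d i)).
Qed.

(* The integral defining normal_derivative splits into two convergent ones only
   at those y where k(., y) is integrable over Omega.  This is automatic off the
   closure of Omega, by the lemma below, so it can fail only on the boundary; and
   it may fail on a set of positive measure when the boundary is not null. *)

Lemma kernel_integrable_exterior (nu : Rd -> R) (k : Rd -> Rd -> R) (Lambda : R)
    (Omega : set Rd) (y : Rd) :
  open Omega -> symmetric_levy_density nu -> symmetric_kernel k ->
  (forall x y, x <> y -> k x y <= Lambda * nu (y - x)) ->
  ~ closure Omega y -> (\int[lambda]_(x in Omega) (k x y)%:E < +oo)%E.
Proof.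
move=> oO [mnu nu0 nuN nuoo] [mk k0 _] kle ycO.
have mO : measurable Omega by exact: measurable_rV_open.
have [e e0 eO] : exists2 e : R, 0 < e & forall x, Omega x ->
    exists i, e <= `|(y - x) ord0 i|.
  have /existsNP[B /not_implyP[/nbhs_ballP[e /= e0 yeB] OB]] := ycO.
  exists e => // x Ox; apply: contrapT => H; apply: OB; exists x; split => //.
  apply: yeB; split => // i j; rewrite ord1.
  rewrite -[ball _ _ _]/(`|y ord0 j - x ord0 j| < e : Prop).
  rewrite ltNge; apply/negP => ej; apply: H; exists j.
  by rewrite !mxE.
pose c := Num.min 1 (e ^+ 2).
have c0 : 0 < c by rewrite lt_min ltr01 exprn_gt0.
pose g (h : Rd) := Num.min 1 (sqnorm2 h) * nu h.
have sq0 h : 0 <= sqnorm2 h by apply: sumr_ge0 => i _; exact: sqr_ge0.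
have g00 : g 0 = 0.
  rewrite /g /sqnorm2 big1 => [|i _]; last by rewrite mxE expr0n.
  by rewrite (min_idPr _) ?mul0r.
have g0 h : 0 <= g h.
  have [->|/eqP h0] := eqVneq h 0.
    by rewrite g00.
  by rewrite mulr_ge0 ?nu0// le_min ler01 sq0.
have mN0 : measurable [set h : Rd | h <> 0].
  have mD := measurable_diag.
  rewrite (_ : mkset _ = (fun h : Rd => (h, 0 : Rd)) @^-1` [set z : Rd * Rd | z.1 <> z.2])//.
  rewrite -[X in measurable X]setTI.
  by apply: (@measurable_fun_pair _ _ _ _ _ _ (fun h : Rd => h) (fun=> 0 : Rd)) => //; exact: measurable_cst.
have mg : measurable_fun setT g.
  rewrite -(setvU [set h : Rd | h <> 0]); apply/measurable_funU => //.
    exact: measurableC.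
  split; last first.
    apply: measurable_funM => //; apply: measurable_minr => //.
    exact: measurable_funTS.
  apply: (@eq_measurable_fun _ _ _ _ _ (fun=> 0 : R)) => //.
    move=> h; rewrite inE /= => /contrapT ->.
    by rewrite g00.
have mk' : measurable_fun Omega (fun x => k x y).
  have yO : ~ Omega y by move=> Oy; apply: ycO; exact: subset_closure.
  apply: (@measurable_comp _ _ _ _ _ _ [set z : Rd * Rd | z.1 <> z.2]
    (fun z => k z.1 z.2) _ (fun x => (x, y))) => //.
    by move=> _ [x Ox <-] /= xy; apply: yO; rewrite -xy.
  apply: measurable_funTS.
  by apply: (@measurable_fun_pair _ _ _ _ _ _ (fun h : Rd => h) (fun=> y)) => //; exact: measurable_cst.
have mgy : measurable_fun setT (fun x : Rd => g (x - y)).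
  by apply: (measurableT_comp mg); exact: (measurable_shift_rV (- y)).
have xy x : Omega x -> x <> y.
  by move=> Ox xy; apply: ycO; apply: subset_closure; rewrite -xy.
have L0 : (0 <= `|Lambda| / c)%R by rewrite divr_ge0// ltW.
apply: (@le_lt_trans _ _ (\int[lambda]_(x in Omega) ((`|Lambda| / c)%:E * (g (x - y))%:E))%E).
  apply: ge0_le_integral => //.
  - by move=> x Ox; rewrite lee_fin k0//; exact: xy.
  - exact/measurable_EFinP.
  - by apply/measurable_EFinP; apply: measurable_funM => //; exact: measurable_funTS.
  - move=> x Ox; rewrite -EFinM lee_fin.
    have xy0 : x - y <> 0 by move=> /subr0_eq; exact: xy.
    apply: (le_trans (kle _ _ (xy _ Ox))).
    rewrite -(opprB x y) nuN//.
    apply: (@le_trans _ _ (`|Lambda| * nu (x - y))).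
      by rewrite ler_wpM2r ?nu0// ler_norm.
    rewrite -mulrA ler_wpM2l// /g mulrA ler_peMl ?nu0//.
    rewrite ler_pdivlMl// mulr1 /c le_min; apply/andP; split.
      by rewrite ge_min lexx.
    rewrite ge_min; apply/orP; right.
    have [i ei] := eO _ Ox.
    rewrite /sqnorm2 (bigD1 i)//= -[X in X <= _]addr0 lerD//; last first.
      by apply: sumr_ge0 => j _; exact: sqr_ge0.
    rewrite -[leRHS]ger0_norm ?sqr_ge0// normrX lerXn2r ?nnegrE ?(ltW e0)//.
    by move: ei; rewrite !mxE -opprB normrN.
have mgO : measurable_fun Omega (fun x : Rd => (g (x - y))%:E).
  by apply/measurable_EFinP; exact: measurable_funTS.
have gO0 x : Omega x -> (0 <= (g (x - y))%:E)%E by rewrite lee_fin.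
rewrite (ge0_integralZl lambda mO mgO gO0) ?lee_fin//.
apply: lte_mul_pinfty; rewrite ?lee_fin//.
apply: (@le_lt_trans _ _ (\int[lambda]_x (g (x - y))%:E)%E).
  apply: ge0_subset_integral => //; last by move=> x _; rewrite lee_fin.
  exact/measurable_EFinP.
have := @ge0_integral_pushforward _ _ _ _ R _ (measurable_shift_rV (- y)) lambda
  setT (EFin \o g) measurableT.
rewrite preimage_setT => <-.
- rewrite (eq_measure_integral lambda)//; first exact: measurable_shift_rV.
  by move=> ms A mA _; exact: lebesgue_rV_shift.
- exact/measurable_EFinP.
- by move=> *; rewrite lee_fin.
Qed.

End nonlocal.

(* Main.v *)
Require Import Defs.
From HB Require Import structures.
From mathcomp Require Import all_boot all_order all_algebra.
From mathcomp Require Import all_classical all_reals all_analysis.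
From mathcomp Require Import unstable measurable_realfun ring lra.

Import Order.TTheory GRing.Theory Num.Theory.
Import numFieldNormedType.Exports.

Local Open Scope classical_set_scope.
Local Open Scope ring_scope.

(** Adding to a minimizer u a multiple of the indicator of a set A outside Omega
changes neither u on Omega nor the linear term of the functional, so that only
the quadratic form reacts.  When the interaction of A with Omega,
  \int_A \int_Omega k(x, y) dx dy,
is finite, such a perturbation stays in the space for every real factor t, and
the minimality of u says that a quadratic polynomial in t, without constant
term, is nonnegative for all t.  Its linear coefficient therefore vanishes
(stationary_quadratic, integral_first_variation).  The domain of the form and its
integrand are symmetric under exchange of the two variables, and on that domain
the increments of the indicator of A are supported where one variable lies in
Omega and the other in A; so this coefficient is a multiple of the flux
  \int_A \int_Omega (u(y) - u(x)) k(x, y) dx dy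
(integral_symmetrized, integral_flux_eq0).  The flux converges absolutely because
|a| <= a^2 + 1: the square is paid for by the energy of u, the constant by the
interaction of A with Omega.  By Fubini it is the integral over A of the normal
derivative (integral_flux).

Fix a set of finite measure outside Omega on which \int_Omega k(x, y) dx is
bounded by a constant.  All its measurable subsets qualify as A, hence the normal
derivative vanishes almost everywhere on it.  Countably many such sets exhaust
the points outside Omega at which \int_Omega k(x, y) dx is finite.

The kernels are only known off the diagonal.  They always meet a factor that
vanishes there, so they are replaced by their extensions by 0 (off_diagonal),
which are measurable on the whole product; the first variation is then computed
for a symmetric kernel on an arbitrary sigma-finite measure space. *)

Set Implicit Arguments.
Unset Strict Implicit.

(** * Stationarity *)

(** At t = - M / (1 + |H|) the polynomial is negative unless M = 0. *)
Lemma stationary_quadratic (R : realFieldType) (M H : R) :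
  (forall t, 0 <= t * M + t ^+ 2 * H) -> M = 0.
Proof.
move=> q; apply/eqP/negPn/negP => M0.
have a0 : 0 < 1 + `|H| by rewrite ltr_pwDl.
have := q (- (M / (1 + `|H|))).
have -> : - (M / (1 + `|H|)) * M + (- (M / (1 + `|H|))) ^+ 2 * H =
    - (M / (1 + `|H|)) ^+ 2 * (1 + `|H| - H).
  by field; rewrite gt_eqF.
apply/negP; rewrite -ltNge mulNr oppr_lt0 mulr_gt0//.
  by rewrite exprn_even_gt0//= mulf_neq0// invr_neq0// gt_eqF.
by rewrite -addrA ltr_pwDl// subr_ge0 ler_norm.
Qed.

Section first_variation.
Context d (T : measurableType d) (R : realType) (mu : {measure set T -> \bar R}).

Lemma integral_first_variation (D : set T) (mD : measurable D) (g m h : T -> R) :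
  mu.-integrable D (EFin \o g) -> mu.-integrable D (EFin \o m) ->
  mu.-integrable D (EFin \o h) ->
  (forall t : R, (\int[mu]_(x in D) (g x)%:E <=
     \int[mu]_(x in D) (g x + t * m x + t ^+ 2 * h x)%:E)%E) ->
  (\int[mu]_(x in D) (m x)%:E = 0)%E.
Proof.
move=> ig im ih le_g.
have fg := integrable_fin_num mD ig.
have fm := integrable_fin_num mD im.
have fh := integrable_fin_num mD ih.
rewrite -(fineK fm); congr EFin.
apply: (@stationary_quadratic R _ (fine (\int[mu]_(x in D) (h x)%:E)%E)) => t.
have := le_g t.
under [leRHS]eq_integral do rewrite !EFinD !EFinM.
have itm : mu.-integrable D (fun x => t%:E * (m x)%:E)%E by exact: integrableZl.
have ith : mu.-integrable D (fun x => (t ^+ 2)%:E * (h x)%:E)%E.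
  exact: integrableZl.
rewrite integralD//; last exact: integrableD.
rewrite integralD// !integralZl//.
rewrite -(fineK fg) -(fineK fm) -(fineK fh) -!EFinM -!EFinD lee_fin /=.
by rewrite -addrA lerDl.
Qed.

End first_variation.

(** * Symmetrization over the domain of the form *)

Section swap.
Context d (T : measurableType d) (R : realType).
Variable mu : {sigma_finite_measure set T -> \bar R}.
Local Notation mu2 := (mu \x mu)%E.

Let ge0_integral_swap (F : T * T -> \bar R) : measurable_fun setT F ->
  (forall z, 0 <= F z)%E ->
  (\int[mu2]_z F (swap z) = \int[mu2]_z F z)%E.
Proof.
move=> mF F0.
have mFs : measurable_fun setT (F \o @swap T T).
  by apply: measurableT_comp => //; exact: measurable_swap.
rewrite [RHS](fubini_tonelli2 F)// (fubini_tonelli1 (F \o @swap T T))//.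
by move=> z; exact: F0.
Qed.

Lemma integral_swap (F : T * T -> \bar R) : measurable_fun setT F ->
  (\int[mu2]_z F (swap z) = \int[mu2]_z F z)%E.
Proof.
move=> mF; rewrite integralE [in RHS]integralE.
rewrite (funepos_comp F) (funeneg_comp F); congr (_ - _)%E.
  exact: (ge0_integral_swap (measurable_funepos mF) (funepos_ge0 F)).
exact: (ge0_integral_swap (measurable_funeneg mF) (funeneg_ge0 F)).
Qed.

Lemma integrable_swap (F : T * T -> \bar R) : mu2.-integrable setT F ->
  mu2.-integrable setT (F \o @swap T T).
Proof.
move=> /integrableP[mF Foo]; apply/integrableP; split.
  by apply: measurableT_comp => //; exact: measurable_swap.
by rewrite (@integral_swap (abse \o F))//; exact: measurableT_comp.
Qed.

End swap.

Section form.
Context d (T : measurableType d) (R : realType).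
Variable mu : {sigma_finite_measure set T -> \bar R}.
Variable Omega : set T.
Hypothesis mOmega : measurable Omega.
Local Notation mu2 := (mu \x mu)%E.
Local Notation D := (~` (~` Omega `*` ~` Omega)).

Let mD : measurable D.
Proof. by apply: measurableC; apply: measurableX; exact: measurableC. Qed.

(** The domain D of the energy form is invariant under exchange of the variables,
so that both halves of the symmetrization have the same integral.  This turns
integrals over D into integrals of densities supported in the strip Omega x T. *)
Lemma integral_symmetrized (G w : T * T -> R) :
  mu2.-integrable setT (EFin \o G) ->
  (forall z, ~ D z -> G z = 0) ->
  (forall z, D z -> w z = G z + G (swap z)) ->
  mu2.-integrable D (EFin \o w) /\
  (\int[mu2]_(z in D) (w z)%:E = 2%:E * \int[mu2]_z (G z)%:E)%E.
Proof.
move=> iG G0 wG.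
have Gs0 z : ~ D z -> G (swap z) = 0.
  by move=> Dz; apply: G0 => Ds; apply: Dz => -[? ?]; exact: Ds.
have wE : (EFin \o w) \_ D =
    (EFin \o G) \+ ((EFin \o G) \o @swap T T).
  apply/funext => z; rewrite patchE; case: ifPn => [/set_mem Dz|/negP Dz] /=.
    by rewrite wG.
  have nDz : ~ D z by move=> ?; apply: Dz; exact/mem_set.
  by rewrite G0// Gs0// adde0.
have iGs := integrable_swap iG.
split.
  by apply/(integrable_mkcond _ mD); rewrite wE; exact: integrableD.
rewrite integral_mkcond wE integralD// integral_swap; last first.
  exact: measurable_int iG.
rewrite -(fineK (integrable_fin_num measurableT iG)) -EFinD -EFinM.
by congr EFin; rewrite mulr_natl mulr2n.
Qed.

Variable k : T -> T -> R.
Hypothesis mk : measurable_fun setT (fun z : T * T => k z.1 z.2).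
Hypothesis k0 : forall x y, 0 <= k x y.
Hypothesis ksym : forall x y, k x y = k y x.

Let measurable_incr (u : T -> R) : measurable_fun setT u ->
  measurable_fun setT (fun z : T * T => u z.1 - u z.2).
Proof.
move=> mu_; apply: measurable_funB.
  by apply: (measurableT_comp mu_); exact: measurable_fst.
by apply: (measurableT_comp mu_); exact: measurable_snd.
Qed.

Let measurable_ind1 (A : set T) : measurable A ->
  measurable_fun setT (fun z : T * T => \1_A z.1 : R).
Proof.
move=> mA; apply: (@measurableT_comp _ _ _ _ _ _ (\1_A : T -> R)) => //.
Qed.

Let measurable_ind2 (A : set T) : measurable A ->
  measurable_fun setT (fun z : T * T => \1_A z.2 : R).
Proof.
move=> mA; apply: (@measurableT_comp _ _ _ _ _ _ (\1_A : T -> R)) => //.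
Qed.

(** The strip Omega x T is one of the two mirror images whose union is D; for
symmetric integrands, estimates over D reduce to estimates on the strip. *)
Definition strip_energy (u : T -> R) (z : T * T) : R :=
  \1_Omega z.1 * ((u z.1 - u z.2) ^+ 2 * k z.1 z.2).

Definition flux_density (u : T -> R) (A : set T) (z : T * T) : R :=
  \1_Omega z.1 * \1_A z.2 * ((u z.2 - u z.1) * k z.1 z.2).

Definition interaction_density (A : set T) (z : T * T) : R :=
  \1_Omega z.1 * \1_A z.2 * k z.1 z.2.

Lemma measurable_strip_energy u : measurable_fun setT u ->
  measurable_fun setT (strip_energy u).
Proof.
move=> mu_; apply: measurable_funM; first exact: measurable_ind1.
by apply: measurable_funM => //; apply: measurable_funX; exact: measurable_incr.
Qed.

Lemma strip_energy_ge0 u z : 0 <= strip_energy u z.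
Proof. by rewrite mulr_ge0// ?indicE// mulr_ge0// sqr_ge0. Qed.

Lemma interaction_density_ge0 A z : 0 <= interaction_density A z.
Proof. by rewrite !mulr_ge0// indicE. Qed.

(** The integrand is dominated on D by the sum of the strip energy and its mirror
image. *)
Lemma integrable_energy_of_strip u :
  measurable_fun setT u ->
  mu2.-integrable setT (EFin \o strip_energy u) ->
  mu2.-integrable D (fun z => ((u z.1 - u z.2) ^+ 2 * k z.1 z.2)%:E).
Proof.
move=> mu_ iu.
have ius := integrable_swap iu.
have isum := integrableS measurableT mD (@subsetT _ _)
  (integrableD measurableT iu ius).
apply: le_integrable isum => //.
  apply/measurable_EFinP; apply: measurable_funTS; apply: measurable_funM => //.
  by apply: measurable_funX; exact: measurable_incr.
move=> z Dz; rewrite -EFinD !abse_EFin lee_fin.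
rewrite ger0_norm; last by rewrite mulr_ge0// sqr_ge0.
rewrite ger0_norm; last by rewrite addr_ge0// strip_energy_ge0.
have [Oz|Oz] := pselect (Omega z.1).
  rewrite [X in _ <= X + _]/strip_energy indicE mem_set// mul1r.
  by rewrite lerDl strip_energy_ge0.
have {Oz} Oz : Omega z.2 by apply: contrapT => Oz2; apply: Dz.
rewrite [X in _ <= _ + X]/strip_energy/= indicE mem_set// mul1r ksym.
by rewrite -sqrrN opprB lerDr strip_energy_ge0.
Qed.

Section perturbation.
Variables (u : T -> R) (A : set T).
Hypothesis mu_ : measurable_fun setT u.
Hypothesis mA : measurable A.
Hypothesis AO : A `<=` ~` Omega.
Hypothesis iu : mu2.-integrable setT (EFin \o strip_energy u).
Hypothesis iA : mu2.-integrable setT (EFin \o interaction_density A).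

(** |a| <= a^2 + 1 with a = u(y) - u(x). *)
Lemma integrable_flux_density : mu2.-integrable setT (EFin \o flux_density u A).
Proof.
have isum := integrableD measurableT iu iA.
apply: le_integrable isum => //.
  apply/measurable_EFinP; apply: measurable_funM.
    by apply: measurable_funM; [exact: measurable_ind1|exact: measurable_ind2].
  apply: measurable_funM => //.
  rewrite (_ : (fun _ => _) = (fun z : T * T => - (u z.1 - u z.2))).
    by apply: measurableT_comp => //; exact: measurable_incr.
  by apply/funext => z; rewrite opprB.
move=> z _; rewrite -EFinD !abse_EFin lee_fin.
rewrite [leRHS]ger0_norm; last first.
  by rewrite addr_ge0 ?strip_energy_ge0 ?interaction_density_ge0.
rewrite /flux_density /strip_energy /interaction_density !indicE.
case: (z.1 \in Omega); last by rewrite !mul0r normr0 addr0.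
case: (z.2 \in A); last first.
  by rewrite mulr0 !mul0r normr0 addr0 !mul1r mulr_ge0// sqr_ge0.
rewrite !mul1r normrM (ger0_norm (k0 _ _)) -[leRHS]/(_ * _ + _).
rewrite -[X in _ <= _ + X]mul1r -mulrDl ler_wpM2r// ler_norml.
set a := u z.1; set b := u z.2.
have := sqr_ge0 (a - b - 1); have := sqr_ge0 (a - b + 1).
by have := sqr_ge0 (a - b); move=> ? ? ?; apply/andP; split; nra.
Qed.

(** (a + b)^2 <= 2 a^2 + 2 b^2, with a the increment of u and b that of the
perturbation; on the strip, b^2 is t^2 if the second variable is in A and 0
otherwise. *)
Lemma integrable_strip_energyD (t : R) :
  mu2.-integrable setT (EFin \o strip_energy (fun x => u x + t * \1_A x)).
Proof.
have i1 : mu2.-integrable setT (fun z => 2%:E * (EFin \o strip_energy u) z)%E.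
  exact: integrableZl.
have i2 : mu2.-integrable setT
    (fun z => (2 * t ^+ 2)%:E * (EFin \o interaction_density A) z)%E.
  exact: integrableZl.
have isum := integrableD measurableT i1 i2.
apply: le_integrable isum => //.
  apply/measurable_EFinP; apply: measurable_strip_energy.
  apply: measurable_funD => //; apply: measurable_funM => //.
move=> z _; rewrite /= lee_fin.
rewrite ger0_norm ?strip_energy_ge0//.
rewrite [leRHS]ger0_norm; last first.
  by rewrite addr_ge0// mulr_ge0 ?strip_energy_ge0 ?interaction_density_ge0//
    mulr_ge0// sqr_ge0.
rewrite /strip_energy /interaction_density !indicE.
case: (boolP (z.1 \in Omega)) => [/set_mem Oz|]; last first.
  by rewrite !mul0r !mulr0 addr0.
have -> : (z.1 \in A) = false by apply: memNset => /AO.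
case: (z.2 \in A) => /=; rewrite !(mul1r,mulr0,mul0r,mulr1,addr0).
  have := k0 z.1 z.2; move: (k _ _) => c c0.
  set a := u z.1; set b := u z.2.
  rewrite mulrA -mulrDl ler_wpM2r//.
  by have := sqr_ge0 (a - b + t); move=> ?; nra.
by rewrite mulr_natl mulr2n lerDl mulr_ge0// sqr_ge0.
Qed.

(** With m the linear and h the quadratic coefficient in t of the perturbed
integrand, the integral of m over D is four times the flux: a factor 2 comes from
expanding the square and another one from the symmetrization. *)
Lemma integral_flux_eq0 :
  (forall t : R,
    (\int[mu2]_(z in D) ((u z.1 - u z.2) ^+ 2 * k z.1 z.2)%:E <=
     \int[mu2]_(z in D) ((u z.1 + t * \1_A z.1 - (u z.2 + t * \1_A z.2)) ^+ 2
        * k z.1 z.2)%:E)%E) ->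
  (\int[mu2]_z (flux_density u A z)%:E = 0)%E.
Proof.
move=> umin.
pose m (z : T * T) := 2 * ((u z.1 - u z.2) * (\1_A z.1 - \1_A z.2) * k z.1 z.2).
pose h (z : T * T) := (\1_A z.1 - \1_A z.2) ^+ 2 * k z.1 z.2.
have flux0 z : ~ D z -> (\1_Omega z.1 : R) = 0.
  by move=> /contrapT[Oz _]; rewrite indicE memNset.
(* A point of D has at most one coordinate in A, and then the other one lies in
   Omega. *)
have D_cases z : D z -> (\1_Omega z.1 = 0 :> R /\ \1_Omega z.2 = 1 :> R /\
      \1_A z.2 = 0 :> R) \/
    (\1_Omega z.1 = 1 :> R /\ \1_A z.1 = 0 :> R /\
      (\1_Omega z.2 = 0 :> R \/ \1_A z.2 = 0 :> R)).
  move=> Dz; have [Oz|Oz] := pselect (Omega z.1); [right|left].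
    rewrite !indicE !(mem_set Oz) (@memNset _ A z.1); last by move=> /AO.
    split => //; split => //.
    have [Oz2|Oz2] := pselect (Omega z.2); [right|left].
      by rewrite memNset// => /AO.
    by rewrite memNset.
  have Oz2 : Omega z.2 by apply: contrapT => Oz2; apply: Dz.
  rewrite !indicE (memNset Oz) (mem_set Oz2) memNset; first by [].
  by move=> /AO.
have [im Em] : mu2.-integrable D (EFin \o m) /\ (\int[mu2]_(z in D) (m z)%:E =
    2%:E * \int[mu2]_z (2 * flux_density u A z)%:E)%E.
  apply: (@integral_symmetrized (fun z => 2 * flux_density u A z)).
  - rewrite (_ : EFin \o _ = fun z => 2%:E * (EFin \o flux_density u A) z)%E//.
    by apply: integrableZl => //; exact: integrable_flux_density.
  - by move=> z /flux0 Oz; rewrite /flux_density Oz !mul0r mulr0.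
  - move=> z Dz; rewrite /m /flux_density/= (ksym z.2 z.1).
    by case: (D_cases _ Dz) => [[-> [-> ->]]|[-> [-> [->|->]]]]; ring.
have [ih _] : mu2.-integrable D (EFin \o h) /\ (\int[mu2]_(z in D) (h z)%:E =
    2%:E * \int[mu2]_z (interaction_density A z)%:E)%E.
  apply: integral_symmetrized => //.
  - by move=> z /flux0 Oz; rewrite /interaction_density Oz !mul0r.
  - have AA x : (\1_A x : R) ^+ 2 = \1_A x.
      by rewrite indicE; case: (_ \in _); rewrite ?expr1n ?expr0n.
    move=> z Dz; rewrite /h /interaction_density/= (ksym z.2 z.1).
    rewrite sqrrB !AA.
    by case: (D_cases _ Dz) => [[-> [-> ->]]|[-> [-> [->|->]]]]; ring.
have : (\int[mu2]_(z in D) (m z)%:E = 0)%E.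
  apply: (@integral_first_variation _ _ _ _ _ _
    (fun z => (u z.1 - u z.2) ^+ 2 * k z.1 z.2) m h) => //.
    exact: integrable_energy_of_strip.
  move=> t; apply: (le_trans (umin t)).
  rewrite le_eqVlt; apply/orP; left; apply/eqP; apply: eq_integral => z _.
  by congr EFin; rewrite /m /h; ring.
rewrite Em => /eqP; rewrite mule_eq0 => /orP[|/eqP].
  by rewrite eqe pnatr_eq0.
under eq_integral do rewrite EFinM.
rewrite integralZl//; last exact: integrable_flux_density.
by move/eqP; rewrite mule_eq0 => /orP[|/eqP//]; rewrite eqe pnatr_eq0.
Qed.

End perturbation.
End form.

(** * Slices: the flux, the energy and the interaction as iterated integrals *)

Section flux_slices.
Context d (T : measurableType d) (R : realType).
Variable mu : {sigma_finite_measure set T -> \bar R}.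
Variables (Omega A : set T) (u : T -> R) (k : T -> T -> R).
Local Notation mu2 := (mu \x mu)%E.
Hypotheses (mOmega : measurable Omega) (mA : measurable A).

Let flux (y : T) : \bar R := (\int[mu]_(x in Omega) ((u y - u x) * k x y)%:E)%E.

Let flux_slice y : fubini_F mu ((EFin \o flux_density Omega k u A) \o @swap T T) y =
  (flux \_ A) y.
Proof.
rewrite /fubini_F patchE; case: ifPn => yA.
  rewrite /flux [RHS]integral_mkcond; apply: eq_integral => x _ /=.
  rewrite patchE /flux_density/= !indicE yA mulr1.
  by case: ifP => _; rewrite ?mul1r ?mul0r.
apply: integral0_eq => x _ /=.
by rewrite /flux_density/= !indicE (negbTE yA) mulr0 mul0r.
Qed.

Lemma integrable_flux : mu2.-integrable setT (EFin \o flux_density Omega k u A) ->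
  mu.-integrable A flux.
Proof.
move=> iF; apply/(integrable_mkcond _ mA).
have := integrable_fubini_F (integrable_swap iF).
by rewrite (_ : fubini_F _ _ = flux \_ A)//; apply/funext; exact: flux_slice.
Qed.

Lemma integral_flux : mu2.-integrable setT (EFin \o flux_density Omega k u A) ->
  (\int[mu]_(y in A) flux y = \int[mu2]_z (flux_density Omega k u A z)%:E)%E.
Proof.
move=> iF; rewrite integral_mkcond.
rewrite -(integral_swap mu (measurable_int _ iF)).
rewrite -(integral12_prod_meas1 (integrable_swap iF)).
by apply: eq_integral => y _; rewrite flux_slice.
Qed.

End flux_slices.

Section strip_comparison.
Context d (T : measurableType d) (R : realType).
Variables (mu : {sigma_finite_measure set T -> \bar R}) (Omega : set T).
Hypothesis mOmega : measurable Omega.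

Lemma le_integrable_strip_energy (k1 k2 : T -> T -> R) (c : R) (u : T -> R) :
  measurable_fun setT (fun z : T * T => k1 z.1 z.2) ->
  (forall x y, 0 <= k1 x y) -> (forall x y, k1 x y <= c * k2 x y) ->
  measurable_fun setT u ->
  (mu \x mu)%E.-integrable setT (EFin \o strip_energy Omega k2 u) ->
  (mu \x mu)%E.-integrable setT (EFin \o strip_energy Omega k1 u).
Proof.
move=> mk1 k10 k12 mu_ i2.
have : (mu \x mu)%E.-integrable setT
    (fun z => c%:E * (EFin \o strip_energy Omega k2 u) z)%E.
  exact: integrableZl.
apply: le_integrable => //.
  by apply/measurable_EFinP; exact: measurable_strip_energy.
move=> z _; rewrite /= lee_fin ger0_norm; last exact: strip_energy_ge0.
apply: (le_trans _ (ler_norm _)); rewrite /strip_energy [leRHS]mulrCA.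
by rewrite ler_wpM2l ?indicE// [leRHS]mulrCA ler_wpM2l// sqr_ge0.
Qed.

(** The finiteness condition in the definition of the energy space, read on the
product space. *)
Lemma integrable_strip_energyP (k : T -> T -> R) (u : T -> R) :
  measurable_fun setT (fun z : T * T => k z.1 z.2) ->
  (forall x y, 0 <= k x y) -> measurable_fun setT u ->
  (mu \x mu)%E.-integrable setT (EFin \o strip_energy Omega k u) <->
  (\int[mu]_(x in Omega) \int[mu]_y ((u x - u y) ^+ 2 * k x y)%:E < +oo)%E.
Proof.
move=> mk k0 mu_.
have mS := measurable_strip_energy mOmega mk mu_.
have -> : (\int[mu]_(x in Omega) \int[mu]_y ((u x - u y) ^+ 2 * k x y)%:E =
    \int[mu]_x \int[mu]_y `|(EFin \o strip_energy Omega k u) (x, y)|)%E.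
  rewrite integral_mkcond; apply: eq_integral => x _; rewrite patchE.
  case: ifPn => xO.
    apply: eq_integral => y _ /=.
    rewrite ger0_norm; last exact: strip_energy_ge0.
    by rewrite /strip_energy/= indicE xO mul1r.
  apply/esym; apply: integral0_eq => y _ /=.
  by rewrite /strip_energy/= indicE (negbTE xO) mul0r normr0.
by apply: integrable12ltyP; exact/measurable_EFinP.
Qed.

Section interaction.
Variable k : T -> T -> R.
Hypothesis mk : measurable_fun setT (fun z : T * T => k z.1 z.2).
Hypothesis k0 : forall x y, 0 <= k x y.

Let measurable_interaction_density (A : set T) : measurable A ->
  measurable_fun setT (EFin \o interaction_density Omega k A).
Proof.
move=> mA; apply/measurable_EFinP; apply: measurable_funM => //.
apply: measurable_funM.
  exact: (@measurableT_comp _ _ _ _ _ _ (\1_Omega : T -> R)).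
exact: (@measurableT_comp _ _ _ _ _ _ (\1_A : T -> R)).
Qed.

Let interaction_density_ge0E (A : set T) z :
  (0 <= (EFin \o interaction_density Omega k A) z)%E.
Proof. by rewrite lee_fin interaction_density_ge0. Qed.

Let interaction_density_slice (A : set T) y :
  fubini_G mu (EFin \o interaction_density Omega k A) y =
  ((fun y => \int[mu]_(x in Omega) (k x y)%:E)%E \_ A) y.
Proof.
rewrite /fubini_G patchE; case: ifPn => yA.
  rewrite [RHS]integral_mkcond; apply: eq_integral => x _ /=.
  rewrite patchE /interaction_density/= !indicE yA mulr1.
  by case: ifP => _; rewrite ?mul1r ?mul0r.
apply: integral0_eq => x _ /=.
by rewrite /interaction_density/= !indicE (negbTE yA) mulr0 mul0r.
Qed.

Lemma measurable_kernel_mass :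
  measurable_fun setT (fun y => \int[mu]_(x in Omega) (k x y)%:E)%E.
Proof.
have := @measurable_fun_fubini_tonelli_G _ _ _ _ _ mu _
  (measurable_interaction_density measurableT) (@interaction_density_ge0E setT).
congr (measurable_fun _ _); apply/funext => y.
by rewrite interaction_density_slice patch_setT.
Qed.

Lemma integrable_interaction_density (A : set T) (n : R) : 0 <= n ->
  measurable A -> (mu A < +oo)%E ->
  (forall y, A y -> (\int[mu]_(x in Omega) (k x y)%:E <= n%:E)%E) ->
  (mu \x mu)%E.-integrable setT (EFin \o interaction_density Omega k A).
Proof.
move=> n0 mA Aoo Kn; have mJ := measurable_interaction_density mA.
apply/integrableP; split => //.
under eq_integral do rewrite gee0_abs//.
rewrite fubini_tonelli2//.
apply: (@le_lt_trans _ _ (\int[mu]_(y in A) (cst n%:E) y)%E); last first.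
  by rewrite integral_cst// lte_mul_pinfty// ?lee_fin.
rewrite [leRHS]integral_mkcond; apply: ge0_le_integral => //.
- by move=> y _; exact: integral_ge0.
- exact: measurable_fun_fubini_tonelli_G.
- by apply/(measurable_restrictT _ mA); exact: measurable_cst.
- move=> y _; rewrite interaction_density_slice !patchE.
  by case: ifPn => // /set_mem; exact: Kn.
Qed.

End interaction.

End strip_comparison.

(** * Kernels extended by 0 to the diagonal *)

Section off_diagonal.
Variables (R : realType) (d : nat).
Local Notation Rd := 'rV[R]_d.

Definition off_diagonal (k : Rd -> Rd -> R) (x y : Rd) : R :=
  if x == y then 0 else k x y.

Lemma off_diagonal_ge0 k : (forall x y, x <> y -> 0 <= k x y) ->
  forall x y, 0 <= off_diagonal k x y.
Proof. by move=> k0 x y; rewrite /off_diagonal; case: eqP => // /k0. Qed.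

Lemma off_diagonal_sym k : (forall x y, x <> y -> k x y = k y x) ->
  forall x y, off_diagonal k x y = off_diagonal k y x.
Proof.
move=> ks x y; rewrite /off_diagonal eq_sym.
by case: eqP => // yx; apply: ks => xy; exact: yx.
Qed.

Lemma mul_off_diagonal (g : R -> R) (u : Rd -> R) k x y : g 0 = 0 ->
  g (u x - u y) * off_diagonal k x y = g (u x - u y) * k x y.
Proof.
by rewrite /off_diagonal; case: eqP => // -> g0; rewrite subrr g0 !mul0r.
Qed.

Lemma measurable_neq0 : measurable [set h : Rd | h <> 0].
Proof.
apply: measurable_rV_open; rewrite (_ : [set _ | _] = ~` [set 0]).
  apply: closed_openC; apply: accessible_closed_set1.
  exact: hausdorff_accessible (@norm_hausdorff _ _).
by apply/seteqP; split.
Qed.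

Lemma measurable_sub_rV : measurable_fun setT (fun z : Rd * Rd => z.1 - z.2).
Proof.
apply: measurable_fun_rV => i.
rewrite (_ : (fun _ => _) =
    (fun z : Rd * Rd => (z.1 ord0 i : measurableTypeR R) - z.2 ord0 i)); last first.
  by apply/funext => z; rewrite !mxE.
apply: (@measurable_funB _ _ R).
  by apply: (measurableT_comp (measurable_coord i)); exact: measurable_fst.
by apply: (measurableT_comp (measurable_coord i)); exact: measurable_snd.
Qed.

Lemma measurable_neq : measurable [set z : Rd * Rd | z.1 <> z.2].
Proof.
have := measurable_sub_rV measurableT measurable_neq0; rewrite setTI.
congr (measurable _); apply/seteqP; split=> z /= zz; contradict zz.
  by rewrite zz subrr.
exact: subr0_eq.
Qed.

Lemma measurable_off_diagonal k :
  measurable_fun [set z : Rd * Rd | z.1 <> z.2] (fun z => k z.1 z.2) ->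
  measurable_fun setT (fun z : Rd * Rd => off_diagonal k z.1 z.2).
Proof.
move=> /(measurable_restrictT _ measurable_neq).
congr (measurable_fun _ _); apply/funext => z; rewrite patchE /off_diagonal.
case: eqP => [zz|zz]; first by rewrite memNset//= => /(_ zz).
by rewrite mem_set.
Qed.

End off_diagonal.

(** * Minimizers *)

Section minimizer.
Variables (R : realType) (d : nat).
Local Notation Rd := 'rV[R]_d.
Local Notation lambda := (lebesgue_rV R d).
Variables (Omega : set Rd) (nu : Rd -> R) (k : Rd -> Rd -> R) (Lambda : R).
Hypotheses (Omega_open : open Omega) (nu_levy : symmetric_levy_density nu).
Hypotheses (k_kernel : symmetric_kernel k) (Lambda_ge1 : 1 <= Lambda).
Hypothesis k_nu : forall x y, x <> y ->
  Lambda^-1 * nu (y - x) <= k x y <= Lambda * nu (y - x).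

Local Notation k' := (off_diagonal k).
Local Notation nu' := (off_diagonal (fun x y => nu (x - y))).
Local Notation mu2 := (lambda \x lambda)%E.

Let mOmega : measurable Omega := measurable_rV_open Omega_open.

Let mk : measurable_fun setT (fun z : Rd * Rd => k' z.1 z.2).
Proof. by case: k_kernel => mk _ _; exact: measurable_off_diagonal. Qed.

Let k0 x y : 0 <= k' x y.
Proof. by case: k_kernel => _ k0 _; exact: off_diagonal_ge0. Qed.

Let ksym x y : k' x y = k' y x.
Proof. by case: k_kernel => _ _ ks; exact: off_diagonal_sym. Qed.

Let neq0 (x y : Rd) : x <> y -> x - y <> 0.
Proof. by move=> xy /subr0_eq. Qed.

Let nu0 x y : 0 <= nu' x y.
Proof.
by case: nu_levy => _ n0 _ _; apply: off_diagonal_ge0 => ? ? /neq0; exact: n0.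
Qed.

Let mnu : measurable_fun setT (fun z : Rd * Rd => nu' z.1 z.2).
Proof.
case: nu_levy => mnu _ _ _; apply: measurable_off_diagonal.
apply: (@measurable_comp _ _ _ _ _ _ [set h : Rd | h <> 0] nu) => //.
- exact: measurable_neq0.
- by move=> _ [z /neq0 zz <-].
- by apply: measurable_funTS; exact: measurable_sub_rV.
Qed.

Let Lambda_gt0 : 0 < Lambda. Proof. exact: lt_le_trans Lambda_ge1. Qed.

Let k_le x y : k' x y <= Lambda * nu' x y.
Proof.
rewrite /off_diagonal; case: eqP => [|xy]; first by rewrite mulr0.
case: nu_levy => _ _ nuN _.
by rewrite -(nuN _ (neq0 xy)) opprB; case/andP: (k_nu xy).
Qed.

Let nu_le x y : nu' x y <= Lambda * k' x y.
Proof.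
rewrite /off_diagonal; case: eqP => [|xy]; first by rewrite mulr0.
case: nu_levy => _ _ nuN _.
rewrite -(nuN _ (neq0 xy)) opprB -ler_pdivrMl//.
by case/andP: (k_nu xy).
Qed.

(** As k and nu are comparable, the energy space may be described through k,
the kernel in which the first variation is computed. *)
Lemma in_V_strip_energy (u : Rd -> R) : in_V nu Omega u <->
  [/\ measurable_fun setT u, in_L2 Omega u &
      mu2.-integrable setT (EFin \o strip_energy Omega k' u)].
Proof.
have E : measurable_fun setT u ->
    mu2.-integrable setT (EFin \o strip_energy Omega nu' u) <->
    (\int[lambda]_(x in Omega) \int[lambda]_y
         ((u x - u y) ^+ 2 * nu (x - y))%:E < +oo)%E.
  move=> mu_; have := integrable_strip_energyP lambda mOmega mnu nu0 mu_.
  have -> // : (\int[lambda]_(x in Omega) \int[lambda]_y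
         ((u x - u y) ^+ 2 * nu' x y)%:E =
    \int[lambda]_(x in Omega) \int[lambda]_y
         ((u x - u y) ^+ 2 * nu (x - y))%:E)%E.
  apply: eq_integral => x _; apply: eq_integral => y _; congr EFin.
  by apply: (mul_off_diagonal (g := fun a => a ^+ 2)); rewrite expr0n.
split=> [[mu_ uL2 uoo]|[mu_ uL2 ui]]; split => //.
  exact: (le_integrable_strip_energy _ _ _ k_le) (proj2 (E mu_) uoo).
apply/(E mu_).
exact: (le_integrable_strip_energy _ _ _ nu_le).
Qed.

Lemma energy_off_diagonal (v : Rd -> R) :
  energy k Omega v v = (2^-1%:E * \int[mu2]_(z in ~` (~` Omega `*` ~` Omega))
    ((v z.1 - v z.2) ^+ 2 * k' z.1 z.2)%:E)%E.
Proof.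
congr (_ * _)%E; apply: eq_integral => z _; congr EFin; rewrite -expr2.
by apply/esym/(mul_off_diagonal (g := fun a => a ^+ 2)); rewrite expr0n.
Qed.

Lemma normal_derivative_off_diagonal (v : Rd -> R) y :
  normal_derivative k Omega v y =
  (\int[lambda]_(x in Omega) ((v y - v x) * k' x y)%:E)%E.
Proof.
apply: eq_integral => x _; congr EFin.
rewrite /off_diagonal; case: eqP => // ->.
by rewrite subrr !mul0r.
Qed.

(** The linear term of the functional has to be finite for it to cancel when the
values at u and at a perturbation of u are compared. *)
Lemma integrable_mul_L2 (f g : Rd -> R) : in_L2 Omega f -> in_L2 Omega g ->
  lambda.-integrable Omega (fun x => (f x * g x)%:E).
Proof.
move=> [mf foo] [mg goo].
have isq (h : Rd -> R) : measurable_fun Omega h ->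
    (\int[lambda]_(x in Omega) (h x ^+ 2)%:E < +oo)%E ->
    lambda.-integrable Omega (EFin \o (fun x => h x ^+ 2)).
  move=> mh hoo; apply/integrableP; split.
    by apply/measurable_EFinP; exact: measurable_funX.
  under eq_integral do rewrite /= ger0_norm ?sqr_ge0//.
  exact: hoo.
have := integrableD mOmega (isq _ mf foo) (isq _ mg goo).
apply: le_integrable => //.
  by apply/measurable_EFinP; exact: measurable_funM.
move=> x _; rewrite /= lee_fin [leRHS]ger0_norm; last first.
  by rewrite addr_ge0// sqr_ge0.
rewrite ler_norml; set a := f x; set b := g x.
have := sqr_ge0 (a - b); have := sqr_ge0 (a + b).
by have := sqr_ge0 a; have := sqr_ge0 b => ? ? ? ?; apply/andP; split; nra.
Qed.

Section test_sets.
Variables f u : Rd -> R.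
Hypotheses (f_L2 : in_L2 Omega f) (u_min : minimizes nu k Omega f u).

Let mu_ : measurable_fun setT u. Proof. by case: u_min => -[]. Qed.

Let iu : mu2.-integrable setT (EFin \o strip_energy Omega k' u).
Proof. by case: u_min => /in_V_strip_energy[]. Qed.

(** Perturbing u by the multiples of the indicator of A keeps it in the energy
space and leaves the linear term unchanged. *)
Lemma minimizer_flux_eq0 (A : set Rd) : measurable A -> A `<=` ~` Omega ->
  mu2.-integrable setT (EFin \o interaction_density Omega k' A) ->
  (\int[mu2]_z (flux_density Omega k' u A z)%:E = 0)%E.
Proof.
move=> mA AO iA; apply: integral_flux_eq0 => // t.
pose v x := u x + t * \1_A x.
have vu x : x \in Omega -> v x = u x.
  move=> /set_mem Ox; rewrite /v indicE memNset ?mulr0 ?addr0//.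
  by move=> /AO; exact.
have [Vu uL2] : in_V nu Omega u /\ in_L2 Omega u by case: u_min => -[].
have Vv : in_V nu Omega v.
  apply/in_V_strip_energy; split.
  - by apply: measurable_funD => //; exact: measurable_funM.
  - case: uL2 => muO uoo; split.
      by apply: (eq_measurable_fun u) => // x /vu.
    rewrite (_ : (\int[lambda]_(x in Omega) _)%E =
      (\int[lambda]_(x in Omega) (u x ^+ 2)%:E)%E)//.
    by apply: eq_integral => x /vu ->.
  - exact: integrable_strip_energyD.
have := u_min.2 v Vv; rewrite /energy_functional !energy_off_diagonal.
have -> : (\int[lambda]_(x in Omega) (f x * v x)%:E =
    \int[lambda]_(x in Omega) (f x * u x)%:E)%E.
  by apply: eq_integral => x /vu ->.
have ffu := integrable_fin_num mOmega (integrable_mul_L2 f_L2 uL2).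
rewrite leeD2rE; last by rewrite fin_numN.
by rewrite !lee_pmul2l// lte_fin invr_gt0.
Qed.

(** The flux out of every measurable subset B of A vanishes, and the normal
derivative is integrable over A, hence determined almost everywhere there by its
integrals over these B. *)
Lemma minimizer_normal_derivative_ae (A : set Rd) (n : nat) :
  measurable A -> (lambda A < +oo)%E -> A `<=` ~` Omega ->
  (forall y, A y -> (\int[lambda]_(x in Omega) (k' x y)%:E <= n%:R%:E)%E) ->
  {ae lambda, forall y, A y -> normal_derivative k Omega u y = 0%E}.
Proof.
move=> mA Aoo AO Kn.
have iJ B : measurable B -> B `<=` A ->
    mu2.-integrable setT (EFin \o interaction_density Omega k' B).
  move=> mB BA.
  apply: (@integrable_interaction_density _ _ _ _ _ mOmega _ mk k0 _ n%:R) => //.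
    by apply: le_lt_trans Aoo; apply: le_measure; rewrite ?inE.
  by move=> y /BA; exact: Kn.
have iF B : measurable B -> B `<=` A ->
    mu2.-integrable setT (EFin \o flux_density Omega k' u B).
  by move=> mB BA; apply: integrable_flux_density => //; exact: iJ.
have : ae_eq lambda A
    (fun y => \int[lambda]_(x in Omega) ((u y - u x) * k' x y)%:E)%E (cst 0%E).
  apply: integral_ae_eq => //; first exact: integrable_flux (iF _ mA _).
  move=> B BA mB; rewrite integral_flux//; last exact: iF.
  rewrite integral0 minimizer_flux_eq0//; first exact: subset_trans AO.
  exact: iJ.
by apply: filterS => y Ny Ay; rewrite normal_derivative_off_diagonal Ny.
Qed.

Lemma minimizer_normal_derivative :
  {ae lambda, forall y, ~ Omega y ->
     (\int[lambda]_(x in Omega) (k x y)%:E < +oo)%E ->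
     normal_derivative k Omega u y = 0%E}.
Proof.
have /sigma_finiteP[F [TF ndF Foo]] := sigma_finiteT lambda.
pose K y := (\int[lambda]_(x in Omega) (k' x y)%:E)%E.
have K0 y : (0 <= K y)%E by apply: integral_ge0 => x _; rewrite lee_fin.
have mK : measurable_fun setT K by exact: measurable_kernel_mass.
pose A n := ~` Omega `&` F n `&` [set y | (K y <= n%:R%:E)%E].
have mA n : measurable (A n).
  apply: emeasurable_fun_infty_c; last exact: measurable_funTS.
  by apply: measurableI; [exact: measurableC|exact: (Foo n).1].
have : {ae lambda, forall y n, A n y -> normal_derivative k Omega u y = 0%E}.
  apply: ae_foralln => n; apply: (@minimizer_normal_derivative_ae _ n) => //.
  - apply: le_lt_trans (Foo n).2; apply: le_measure; rewrite ?inE//.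
      exact: (Foo n).1.
    by move=> y [[]].
  - by move=> y [[]].
  - by move=> y [].
apply: filterS => y Ny Oy Koo.
have KE : K y = (\int[lambda]_(x in Omega) (k x y)%:E)%E.
  apply: eq_integral => x /set_mem Ox; rewrite /off_diagonal.
  by case: eqP => // xy; rewrite xy in Ox.
rewrite -KE in Koo.
have [i _ Fi] : (\bigcup_i F i) y by rewrite -TF.
have fK : K y \is a fin_num by rewrite ge0_fin_numE.
pose n := Num.bound (fine (K y)).
apply: (Ny (maxn i n)); split; first split => //.
  by have /subsetPset := ndF _ _ (leq_maxl i n); exact.
rewrite /= -(fineK fK) lee_fin; apply: (@le_trans _ _ n%:R).
  exact: ltW (archi_boundP (fine_ge0 (K0 y))).
by rewrite ler_nat leq_maxr.
Qed.

End test_sets.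
End minimizer.

Unset Implicit Arguments.
Set Strict Implicit.

Theorem corollary4p8 (R : realType) (d : nat) (d_gt0 : (0 < d)%N)
  (Omega : set 'rV[R]_d) (Omega_open : open Omega)
  (nu : 'rV[R]_d -> R) (nu_levy : symmetric_levy_density nu)
  (k : 'rV[R]_d -> 'rV[R]_d -> R) (k_kernel : symmetric_kernel k)
  (Lambda : R) (Lambda_ge1 : 1 <= Lambda)
  (k_nu : forall x y, x <> y ->
     Lambda^-1 * nu (y - x) <= k x y <= Lambda * nu (y - x))
  (f : 'rV[R]_d -> R) (f_L2 : in_L2 Omega f)
  (u : 'rV[R]_d -> R) (u_min : minimizes nu k Omega f u) :
  {ae lebesgue_rV R d, forall y, ~ Omega y ->
     (\int[lebesgue_rV R d]_(x in Omega) (k x y)%:E < +oo)%E ->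
     normal_derivative k Omega u y = 0%E}.
Proof.
exact: (minimizer_normal_derivative Omega_open nu_levy k_kernel Lambda_ge1 k_nu
  f_L2 u_min).
Qed.
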